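(* Let $\mathcal{A}=(A_1,\dots,A_k)$, where each $A_i=\{a_{i,1},\dots,a_{i,m_i}\}$ is a multi-subset of $\mathbb{Z}^n$ with $m_i\ge 2$, and let $m=m_1+\cdots+m_k$. The support of the tropicalization of the resultant variety $\mathcal{R}(\mathcal{A})\subseteq\prod_{i=1}^k(\mathbb{C}^* )^{A_i}$ coincides, as a subset of $\mathbb{R}^m$, with the tropical resultant $\mathcal{TR}(\mathcal{A})$.
   Context: Points in $A_i$ need not be distinct. $(\mathbb{C}^* )^{A_i}$ is the set of polynomials $\sum_{j=1}^{m_i}c_{ij}x^{a_{ij}}$ in $x=(x_1,\dots,x_n)$ with all $c_{ij}\in\mathbb{C}^*$, identified with $(\mathbb{C}^* )^{m_i}$ via coefficients. The resultant variety $\mathcal{R}(\mathcal{A})$ is the closure in $\prod_{i=1}^k(\mathbb{C}^* )^{A_i}\cong(\mathbb{C}^* )^m$ of the set of tuples $(f_1,\dots,f_k)$ such that $f_1=\cdots=f_k=0$ has a solution in $(\mathbb{C}^* )^n$. A tropical polynomial with support $A_i$ is $F_i=\bigoplus_{j}c_{ij}\odot x^{\odot a_{ij}}$, i.e. $F_i(x)=\min_j(c_{ij}+a_{ij}\cdot x)$, with coefficients $(c_{ij})_j\in\mathbb{R}^{A_i}=\mathbb{R}^{m_i}$. Its tropical solution set $\mathcal{T}(F_i)\subseteq\mathbb{R}^n$ is the set of $x$ at which the minimum is attained by at least two indices $j$ (terms with equal exponents but different indices count as different). The tropical resultant $\mathcal{TR}(\mathcal{A})\subseteq\mathbb{R}^m=\prod_i\mathbb{R}^{A_i}$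 is the set of tuples $(F_1,\dots,F_k)$ with $\mathcal{T}(F_1)\cap\cdots\cap\mathcal{T}(F_k)\neq\emptyset$. For a subvariety of a torus over a field $\mathbf{k}$ with defining ideal $I$, the support of the tropicalization is $\{\omega: \text{the initial ideal } \mathrm{in}_\omega(I)\text{ contains no monomial}\}$, where $\mathrm{in}_\omega$ selects the terms of smallest $\omega$-degree and any valuation on $\mathbf{k}$ is disregarded. *)

(* Defs.v *)
From HB Require Import structures.
From mathcomp Require Import all_boot all_order all_algebra finmap.
From mathcomp Require Import complex.
From mathcomp Require Import boolp classical_sets reals.
From mathcomp.multinomials Require Import monalg.

Set Implicit Arguments.
Unset Strict Implicit.
Unset Printing Implicit Defensive.

Import Order.TTheory GRing.Theory Num.Theory.

Local Open Scope classical_set_scope.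
Local Open Scope ring_scope.

(* The Laurent polynomial ring K[x_t, x_t^-1 | t in T]: finitely supported     *)
(* functions from exponent vectors in Z^T to K.  The module structure, the     *)
(* support [msupp], the coefficients [g@_e] and the terms [<< c *g e >>] are   *)
(* those of monalg; the product has to be given here because monalg only       *)
(* provides it over monoids without nontrivial units, which excludes Z^T.      *)
Definition laurent (K : fieldType) (T : finType) : Type :=
  {malg K[{ffun T -> int}]}.

HB.instance Definition _ (K : fieldType) (T : finType) :=
  GRing.Lmodule.on (laurent K T).
Section LaurentRing.
Context (K : fieldType) (T : finType).
Implicit Types (g : laurent K T) (e : {ffun T -> int}).

Definition lterm (c : K) e : laurent K T := << c *g e >>.

Definition lmul g1 g2 : laurent K T :=
  \sum_(e1 <- msupp g1) \sum_(e2 <- msupp g2)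
    lterm (g1@_e1 * g2@_e2) (e1 + e2).

Lemma ltermD c1 c2 e : lterm (c1 + c2) e = lterm c1 e + lterm c2 e.
Proof. exact: (raddfD (mkmalgU e)). Qed.

Lemma lterm0 e : lterm 0 e = 0.
Proof. exact: (raddf0 (mkmalgU e)). Qed.

Lemma lmulEw (d1 d2 : {fset {ffun T -> int}}) g1 g2 :
  (msupp g1 `<=` d1)%fset -> (msupp g2 `<=` d2)%fset ->
  lmul g1 g2 = \sum_(e1 <- d1) \sum_(e2 <- d2)
    lterm (g1@_e1 * g2@_e2) (e1 + e2).
Proof.
move=> le1 le2; rewrite /lmul (big_fset_incl _ le1) /=.
  apply/eq_bigr=> e1 _; apply/big_fset_incl => // e _ /mcoeff_outdom ->.
  by rewrite mulr0 lterm0.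
move=> e _ /mcoeff_outdom ge.
by rewrite big1 => // e' _; rewrite ge mul0r lterm0.
Qed.

Lemma lmulC : commutative lmul.
Proof.
move=> g1 g2; rewrite /lmul exchange_big /=.
by apply/eq_bigr=> e1 _; apply/eq_bigr=> e2 _; rewrite mulrC addrC.
Qed.

Lemma lmulDl : left_distributive lmul +%R.
Proof.
move=> g1 g2 g; set d := (msupp g1 `|` msupp g2)%fset.
rewrite (@lmulEw d (msupp g)) ?msuppD_le ?fsubset_refl //.
rewrite (@lmulEw d (msupp g) g1) ?fsubsetUl ?fsubset_refl //.
rewrite (@lmulEw d (msupp g) g2) ?fsubsetUr ?fsubset_refl //.
rewrite -big_split /=; apply/eq_bigr=> e1 _.
rewrite -big_split /=; apply/eq_bigr=> e2 _.
by rewrite (mcoeffD e1) mulrDl ltermD.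
Qed.

Lemma lmul0 : left_zero 0 lmul.
Proof. by move=> g; rewrite /lmul msupp0 big_seq_fset0. Qed.

Lemma lmulTT c1 c2 e1 e2 :
  lmul (lterm c1 e1) (lterm c2 e2) = lterm (c1 * c2) (e1 + e2).
Proof.
by rewrite (@lmulEw [fset e1]%fset [fset e2]%fset) ?msuppU_le //
     !big_seq_fset1 !mcoeffUU.
Qed.

Lemma laurentE g : g = \sum_(e <- msupp g) lterm g@_e e.
Proof. exact: monalgE. Qed.

Lemma lmul_suml (I : Type) (r : seq I) (F : I -> laurent K T) g :
  lmul (\sum_(i <- r) F i) g = \sum_(i <- r) lmul (F i) g.
Proof. exact: (big_morph (lmul^~ g) (fun _ _ => lmulDl _ _ _) (lmul0 g)). Qed.

Lemma lmul_sumr (I : Type) (r : seq I) (F : I -> laurent K T) g :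
  lmul g (\sum_(i <- r) F i) = \sum_(i <- r) lmul g (F i).
Proof. by rewrite lmulC lmul_suml; apply: eq_bigr => i _; rewrite lmulC. Qed.

Lemma lmulA : associative lmul.
Proof.
move=> g1 g2 g3; rewrite (laurentE g1) (laurentE g2) (laurentE g3).
rewrite !lmul_suml; apply: eq_bigr => e1 _.
rewrite [LHS]lmul_sumr [X in _ = lmul X _]lmul_sumr lmul_suml.
apply: eq_bigr => e2 _; rewrite !lmul_sumr; apply: eq_bigr => e3 _.
by rewrite !lmulTT mulrA addrA.
Qed.

Lemma lmul1 : left_id (lterm 1 0) lmul.
Proof.
move=> g; rewrite [in LHS](laurentE g) [RHS]laurentE lmul_sumr.
by apply: eq_bigr => e _; rewrite lmulTT mul1r add0r.
Qed.

Lemma laurent1_neq0 : lterm 1 0 != 0.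
Proof. by rewrite monalgU_eq0 oner_eq0. Qed.

HB.instance Definition _ := GRing.Zmodule_isComNzRing.Build (laurent K T)
  lmulA lmulC lmul1 lmulDl laurent1_neq0.

End LaurentRing.

Section TorusGeometry.
Context (K : fieldType) (T : finType).
Implicit Types (G I : set (laurent K T)) (X : set (T -> K)).

Definition torus : set (T -> K) := [set x | forall t, x t != 0].

Definition monomial_eval (x : T -> K) (e : {ffun T -> int}) : K :=
  \prod_(t : T) x t ^ e t.

Definition leval (x : T -> K) (g : laurent K T) : K :=
  \sum_(e <- msupp g) g@_e * monomial_eval x e.

Definition zero_locus G : set (T -> K) :=
  [set x | torus x /\ forall g, G g -> leval x g = 0].

Definition zariski_closure X : set (T -> K) :=
  \bigcap_(G in [set G | X `<=` zero_locus G]) zero_locus G.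

Definition vanishing_ideal X : set (laurent K T) :=
  [set g | forall x, X x -> leval x g = 0].

Definition is_ideal I : Prop :=
  [/\ I 0, forall f g, I f -> I g -> I (f + g)
    & forall f g : laurent K T, I g -> I (f * g)].

Definition ideal_generated G : set (laurent K T) :=
  \bigcap_(I in [set I | is_ideal I /\ G `<=` I]) I.

End TorusGeometry.

Arguments torus : clear implicits.

Section Tropicalization.
Context (R : realType) (K : fieldType) (T : finType).
Implicit Types (w : T -> R) (I : set (laurent K T)).

Definition wdeg w (e : {ffun T -> int}) : R := \sum_(t : T) w t * (e t)%:~R.

(* Coefficients do not contribute to the weight: K is not valued. *)
Definition initial_form w (g : laurent K T) : laurent K T :=
  \sum_(e <- msupp g | all (fun e' => wdeg w e <= wdeg w e') (msupp g))
    lterm g@_e e.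

Definition initial_ideal w I : set (laurent K T) :=
  ideal_generated (initial_form w @` I).

Definition trop_support I : set (T -> R) :=
  [set w | ~ exists e, initial_ideal w I (lterm 1 e)].

End Tropicalization.

Section TropicalHypersurface.
Context (R : realType) (n : nat) (J : finType).

Definition trop_term (a : J -> {ffun 'I_n -> int}) (c : J -> R)
    (x : 'I_n -> R) (j : J) : R :=
  c j + \sum_(l < n) (a j l)%:~R * x l.

Definition minimal_terms (a : J -> {ffun 'I_n -> int}) (c : J -> R)
    (x : 'I_n -> R) : pred J :=
  fun j => [forall j', trop_term a c x j <= trop_term a c x j'].

Definition trop_hypersurface (a : J -> {ffun 'I_n -> int}) (c : J -> R) :
    set ('I_n -> R) :=
  [set x | (2 <= #|minimal_terms a c x|)%N].

End TropicalHypersurface.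

(* Index type of the m_1 + ... + m_k coefficients c_ij.  A multi-subset A_i of *)
(* Z^n is a family [a i : 'I_(m i) -> Z^n], so repetitions are allowed.        *)
Notation coef_index m := {i : 'I__ & 'I_(m i)}.

Section Resultants.
Context (R : realType) (k n : nat) (m : 'I_k -> nat).
Variable a : forall i : 'I_k, 'I_(m i) -> {ffun 'I_n -> int}.

Definition has_common_root (c : coef_index m -> R[i]) : Prop :=
  exists2 x : 'I_n -> R[i], torus R[i] 'I_n x &
    forall i : 'I_k,
      \sum_(j < m i) c (existT _ i j) * monomial_eval x (a j) = 0.

Definition resultant_variety : set (coef_index m -> R[i]) :=
  zariski_closure
    [set c | torus R[i] (coef_index m) c /\ has_common_root c].

Definition tropical_resultant : set (coef_index m -> R) :=
  [set c | exists x : 'I_n -> R, forall i : 'I_k,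
     trop_hypersurface (@a i) (fun j => c (existT _ i j)) x].

End Resultants.

Arguments resultant_variety R {k n m} a.
Arguments tropical_resultant R {k n m} a.

(* Main.v *)
Require Import Defs.
From HB Require Import structures.
From mathcomp Require Import all_boot all_order all_algebra finmap.
From mathcomp Require Import complex.
From mathcomp Require Import boolp classical_sets reals.
From mathcomp.multinomials Require Import monalg.
From mathcomp Require Import ring lra zify.
From mathcomp Require Import functions topology normedtype sequences exp.

(** Let [Y] be the incidence variety of pairs (c, x) with x a common root of the
    system c, and let w be a weight.

    If in_w(I) contains no monomial, consider the functions on [Y]: those induced
    by Laurent polynomials in c of weight >= 0 form a ring [O], those of weight
    > 0 an ideal [P] of it, and 1 is not in [P], since 1 = g on [Y] with g of
    positive weight would put 1 - g, whose initial form is 1, in I.  Chevalley's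
    extension argument enlarges (O, P) until any two of the monomials
    u_ij = c_ij x^(a_ij) are comparable for divisibility in [O].  As
    sum_j u_ij = 0, the smallest u_ij occurs twice for each i.  The resulting
    linear inequalities in x have a real solution by Fourier-Motzkin: an integral
    certificate of infeasibility would be a monomial in c of negative weight lying
    in [O], whereas its inverse lies in [P].

    Conversely, from a real point x realising w in the tropical resultant one
    writes down real curves c_ij(s) = exp(-s w_ij) h_ij(s) in the resultant
    variety with h(s) -> p in the torus as s -> +oo; every initial form in
    in_w(I) vanishes at p, so none of the elements of in_w(I) is a monomial. *)

Set Implicit Arguments.
Unset Strict Implicit.
Unset Printing Implicit Defensive.
Import Order.TTheory GRing.Theory Num.Theory numFieldNormedType.Exports.
Local Open Scope ring_scope.

(** * Integral Fourier-Motzkin elimination over an ordered field *)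

Section FourierMotzkin.
Context (F : realFieldType) (V : zmodType).

Lemma between_seqs (L U : seq F) :
  (forall l u, l \in L -> u \in U -> l <= u) ->
  exists x, (forall l, l \in L -> l <= x) /\ (forall u, u \in U -> x <= u).
Proof.
elim: L => [|l L IH] LU.
  exists (\big[Order.min/0]_(u <- U) u); split=> // u uU.
  exact: ge_bigmin_seq.
have [|x [Lx xU]] := IH; first by move=> l' u l'L; apply: LU; rewrite inE l'L orbT.
exists (Num.max l x); split=> [l'|u uU].
  by rewrite inE le_max => /orP[/eqP->|/Lx->]; rewrite ?lexx ?orbT.
by rewrite ge_max xU // LU ?mem_head.
Qed.

Lemma mulrn_absz_cancel (x y : int) : 0 < x -> y < 0 ->
  x *+ `|y|%N + y *+ `|x|%N = 0.
Proof.
move=> x0 y0; rewrite -(mulr_natr x) -(mulr_natr y) !natz; lia.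
Qed.

(* Fourier-Motzkin elimination in which the certificate of infeasibility is an
   integral combination: [Q] stands for the semigroup spanned by [s]. *)
Lemma fourier_motzkin (n : nat) (co : 'I_n -> {additive V -> int})
    (b : {additive V -> F}) (Q : V -> Prop) (s : seq V) :
  (forall v w, Q v -> Q w -> Q (v + w)) ->
  (forall v, v \in s -> Q v) ->
  (forall v, Q v -> (forall l, co l v = 0) -> 0 <= b v) ->
  exists x : 'I_n -> F,
    forall v, v \in s -> 0 <= b v + \sum_(l < n) (co l v)%:~R * x l.
Proof.
elim: n co Q s => [|n IH] co Q s QD Qs Q0.
  exists (fun=> 0) => v /Qs Qv; rewrite big_ord0 addr0.
  by apply: Q0 => // -[].
(* [Q] is a semigroup that may miss 0, so only positive multiples are available. *)
have QM v k : Q v -> Q (v *+ k.+1).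
  by move=> Qv; elim: k => [|k IHk]; rewrite ?mulr1n // mulrS; apply: QD.
pose co' (l : 'I_n) := co (widen_ord (leqnSn n) l).
pose c : {additive V -> int} := co ord_max.
(* For [c v > 0 > c w] both multipliers are positive and the last coordinate cancels. *)
pose comb v w := v *+ `|c w|%N + w *+ `|c v|%N.
pose s' := [seq v <- s | c v == 0] ++
  [seq comb v w | v <- [seq v <- s | 0 < c v], w <- [seq w <- s | c w < 0]].
have [x xP] : exists x : 'I_n -> F,
    forall v, v \in s' -> 0 <= b v + \sum_(l < n) (co' l v)%:~R * x l.
  (* Restricting the semigroup to the kernel of [c] turns a certificate in [n] coordinates into one
     in [n.+1]. *)
  apply: (IH co' (fun v => Q v /\ c v = 0) s').
  - move=> v w [Qv cv] [Qw cw]; split; first exact: QD.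
    by rewrite raddfD cv cw addr0.
  - move=> v; rewrite mem_cat => /orP[|/allpairsP[[v1 v2] /= []]].
      by rewrite mem_filter => /andP[/eqP ? /Qs].
    rewrite !mem_filter => /andP[c1 /Qs Q1] /andP[c2 /Qs Q2] ->; rewrite /comb; split.
      have [k ->] : exists k, `|c v1|%N = k.+1 by exists `|c v1|%N.-1; lia.
      have [k' ->] : exists k', `|c v2|%N = k'.+1 by exists `|c v2|%N.-1; lia.
      by apply: QD; apply: QM.
    by rewrite raddfD !raddfMn mulrn_absz_cancel.
  - move=> v [Qv cv] co0; apply: Q0 => // l.
    have [ln|] := ltnP l n.
      by rewrite -(co0 (Ordinal ln)); congr (co _ _); apply: val_inj.
    move=> nl; rewrite -cv; congr (co _ _); apply: val_inj => /=.
    by have := ltn_ord l; lia.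
pose e v := b v + \sum_(l < n) (co' l v)%:~R * x l.
have eD v w : e (v + w) = e v + e w.
  rewrite /e raddfD addrACA -big_split /=; congr (_ + _).
  by apply: eq_bigr => l _; rewrite raddfD rmorphD mulrDl.
have e0 : e 0 = 0.
  by have := eD 0 0; rewrite addr0 => h; apply: (addrI (e 0)); rewrite addr0.
have eM v k : e (v *+ k) = e v *+ k.
  by elim: k => [|k IHk]; rewrite ?mulr0n // !mulrS eD IHk.
(* Vectors with [c v > 0] bound the last unknown from below by [- e v / c v], those with [c v < 0]
   from above; the combined vectors in [s'] make these bounds compatible. *)
have [t [tL tU]] : exists t,
    (forall l, l \in [seq - e v / (c v)%:~R | v <- [seq v <- s | 0 < c v]] -> l <= t) /\
    (forall u, u \in [seq - e v / (c v)%:~R | v <- [seq v <- s | c v < 0]] -> t <= u).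
  apply: between_seqs => _ _ /mapP[v vs ->] /mapP[w ws ->].
  have : comb v w \in s'.
    by rewrite mem_cat; apply/orP; right; apply: allpairs_f.
  move: vs ws; rewrite !mem_filter => /andP[cv vs] /andP[cw ws].
  move=> /xP; rewrite -/(e _) /comb eD !eM -(mulr_natr (e v)) -(mulr_natr (e w)).
  have -> : `|c w|%:R = - (c w)%:~R :> F.
    by rewrite pmulrn -mulrNz; congr (_%:~R); lia.
  have -> : `|c v|%:R = (c v)%:~R :> F.
    by rewrite pmulrn; congr (_%:~R); lia.
  have : (0 : F) < (c v)%:~R by rewrite ltr0z.
  have : (c w)%:~R < (0 : F) by rewrite ltrz0.
  move: (c v)%:~R (c w)%:~R => p q q0 p0 h.
  rewrite ler_pdivrMr // mulrAC ler_ndivlMr //; lra.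
pose xx (l : 'I_n.+1) := if insub (val l) is Some l' then x l' else t.
exists xx => v vs; rewrite big_ord_recr /= addrA.
have -> : xx ord_max = t by rewrite /xx insubN //= ltnn.
have -> : \sum_(i < n) (co (widen_ord (leqnSn n) i) v)%:~R *
            xx (widen_ord (leqnSn n) i) = \sum_(l < n) (co' l v)%:~R * x l.
  apply: eq_bigr => i _; rewrite /xx /= (insubT (fun k => k < n)%N (ltn_ord i)) /=.
  by congr (_ * x _); apply: val_inj.
rewrite -/(e v) -/c.
have [cv|cv|cv] := ltgtP (c v) 0.
- have : - e v / (c v)%:~R \in [seq - e v / (c v)%:~R | v <- [seq v <- s | c v < 0]].
    by apply: map_f; rewrite mem_filter cv.
  move/tU; rewrite ler_ndivlMr ?ltrz0 //; lra.
- have : - e v / (c v)%:~R \in [seq - e v / (c v)%:~R | v <- [seq v <- s | 0 < c v]].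
    by apply: map_f; rewrite mem_filter cv.
  move/tL; rewrite ler_pdivrMr ?ltr0z //; lra.
- have := xP v; rewrite cv mul0r addr0; apply.
  by rewrite mem_cat mem_filter cv eqxx vs.
Qed.
End FourierMotzkin.

(** * Adjoining an element to a subring while keeping an ideal proper *)

Section Chevalley.
Context (B : comPzRingType).
Implicit Types (O P S : B -> Prop) (y z s t : B).

Record subring_ideal O P : Prop := {
  si_one : O 1;
  si_Oadd : forall a b, O a -> O b -> O (a + b);
  si_Oopp : forall a, O a -> O (- a);
  si_Omul : forall a b, O a -> O b -> O (a * b);
  si_zero : P 0;
  si_Padd : forall a b, P a -> P b -> P (a + b);
  si_Pmul : forall a b, O a -> P b -> P (a * b);
  si_sub : forall a, P a -> O a }.

(** The coefficient set [S] is arbitrary, so that one definition yields both the ring O[y] and its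
    ideal P[y]; [n] only bounds the degree. *)
Definition adjoin_deg S y n b :=
  exists2 f : nat -> B, (forall i, S (f i)) & b = \sum_(i < n.+1) f i * y ^+ i.

Definition adjoin S y b := exists n, adjoin_deg S y n b.

Lemma adjoin_deg_le S y n n' b : S 0 -> (n <= n')%N ->
  adjoin_deg S y n b -> adjoin_deg S y n' b.
Proof.
move=> S0 nn' [f Sf ->]; exists (fun i => if (i < n.+1)%N then f i else 0).
  by move=> i; case: ifP.
rewrite (big_ord_widen n'.+1 (fun i => f i * y ^+ i)) // big_mkcond /=.
by apply: eq_bigr => i _; case: ifP; rewrite ?mul0r.
Qed.

Lemma adjoin_degD S y n b c : (forall a a', S a -> S a' -> S (a + a')) ->
  adjoin_deg S y n b -> adjoin_deg S y n c -> adjoin_deg S y n (b + c).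
Proof.
move=> SD [f Sf ->] [g Sg ->]; exists (fun i => f i + g i); first by auto.
by rewrite -big_split; apply: eq_bigr => i _; rewrite mulrDl.
Qed.

Lemma adjoin_deg_mulX S y n i a : S 0 -> S a -> (i <= n)%N ->
  adjoin_deg S y n (a * y ^+ i).
Proof.
move=> S0 Sa le_in; apply: (@adjoin_deg_le _ _ i) => //.
exists (fun j => if j == i then a else 0); first by move=> j; case: ifP.
rewrite big_ord_recr /= eqxx big1 ?add0r // => j _.
by rewrite ltn_eqF ?mul0r.
Qed.

Lemma adjoin_deg_sum S y n (I : finType) (p : pred I) (h : I -> B) : S 0 ->
  (forall a a', S a -> S a' -> S (a + a')) ->
  (forall i, p i -> adjoin_deg S y n (h i)) -> adjoin_deg S y n (\sum_(i | p i) h i).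
Proof.
move=> S0 SD hS; elim/big_ind: _ => //; last by move=> *; apply: adjoin_degD.
by rewrite -(mul0r (y ^+ 0)); apply: adjoin_deg_mulX.
Qed.

Lemma adjoinD S y b c : S 0 -> (forall a a', S a -> S a' -> S (a + a')) ->
  adjoin S y b -> adjoin S y c -> adjoin S y (b + c).
Proof.
move=> S0 SD [n bn] [n' cn]; exists (maxn n n').
by apply: adjoin_degD => //; [apply: adjoin_deg_le bn|apply: adjoin_deg_le cn];
  rewrite ?leq_maxl ?leq_maxr.
Qed.

(** Two coefficient sets, because O[y] has to be closed under products and P[y] under products with
    O[y]. *)
Lemma adjoinM S S' y b c : S' 0 -> (forall a a', S' a -> S' a' -> S' (a + a')) ->
  (forall a a', S a -> S' a' -> S' (a * a')) ->
  adjoin S y b -> adjoin S' y c -> adjoin S' y (b * c).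
Proof.
move=> S0 SD SM [n [f Sf ->]] [n' [g Sg ->]]; exists (n + n')%N.
rewrite mulr_suml; apply: adjoin_deg_sum => // i _.
rewrite mulr_sumr; apply: adjoin_deg_sum => // j _.
rewrite mulrACA -exprD; apply: adjoin_deg_mulX => //; first exact: SM.
by apply: leq_add; rewrite -ltnS.
Qed.

Lemma adjoin_id S y b : S 0 -> S b -> adjoin S y b.
Proof.
by move=> S0 Sb; exists 0%N; rewrite -[b]mulr1 -(expr0 y); apply: adjoin_deg_mulX.
Qed.

Lemma adjoin_gen O P y : subring_ideal O P -> adjoin O y y.
Proof.
move=> H; exists 1%N; rewrite -[X in adjoin_deg _ _ _ X]mul1r -[X in 1 * X]expr1.
by apply: adjoin_deg_mulX => //; [apply: (si_sub H); apply: (si_zero H)|apply: (si_one H)].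
Qed.

Lemma subring_ideal_adjoin O P y : subring_ideal O P ->
  subring_ideal (adjoin O y) (adjoin P y).
Proof.
move=> H; have [O1 OD ON OM P0 PD PM PO] := H.
have O0 := PO _ P0.
split.
- exact: adjoin_id.
- by move=> a b; apply: adjoinD.
- move=> a [n [f fO ->]]; exists n; exists (fun i => - f i); first by auto.
  by rewrite -sumrN; apply: eq_bigr => i _; rewrite mulNr.
- by move=> a b; apply: adjoinM.
- exact: adjoin_id.
- by move=> a b; apply: adjoinD.
- by move=> a b; apply: adjoinM.
- by move=> a [n [f fP ->]]; exists n; exists f => // i; apply: PO.
Qed.

Context (O P : B -> Prop) (OP : subring_ideal O P) (P_proper : ~ P 1).

Let Popp a : P a -> P (- a).
Proof.
move=> Pa; rewrite -mulN1r; apply: (si_Pmul OP) => //.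
by apply: (si_Oopp OP); apply: (si_one OP).
Qed.

(** The multiplicative set 1 + P, expressed by [P (1 - s)], takes the place of the units of a local
    ring. *)
Let unit_mul s t : P (1 - s) -> P (1 - t) -> P (1 - s * t).
Proof.
move=> Ps Pt.
have -> : 1 - s * t = (1 - s) + (1 - t) - (1 - s) * (1 - t) by ring.
apply: (si_Padd OP); first exact: (si_Padd OP).
by apply: Popp; apply: (si_Pmul OP) => //; apply: (si_sub OP).
Qed.

Let unit_notin s : P (1 - s) -> ~ P s.
Proof.
move=> Ps P's; apply: P_proper; rewrite -(subrK s 1); exact: (si_Padd OP).
Qed.

(* Multiplying a relation by t - q_0, where t = q_0 + ... + q_m z^m, lets one
   replace its leading power of y by lower ones. *)
Lemma adjoin_deg_reduce y z s t n m : y * z = 1 -> (0 < m <= n.+1)%N ->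
  P (1 - s) -> P (1 - t) ->
  adjoin_deg P y n.+1 s -> adjoin_deg P z m t ->
  exists2 s', P (1 - s') & adjoin_deg P y n s'.
Proof.
move=> yz /andP[m0 mn] Ps Pt [p pP sE] [q qP tE].
have [O1 OD ON OM P0 PD PM PO] := OP.
have Pt0 : P (1 - (t - q 0%N)).
  by rewrite opprB addrCA addrC; apply: PD.
have Ot0 : O (t - q 0%N).
  by rewrite -[_ - _](subKr 1); apply: OD => //; apply: ON; apply: PO.
exists (s * (t - q 0%N)); first exact: unit_mul.
(* Each [z] cancels a [y]. As [m <= n.+1] the exponents [n - j] are not truncated, and with [q 0]
   removed no power above [y ^+ n] remains. *)
have tE' : (t - q 0%N) * y ^+ n.+1 =
    \sum_(j < m) q j.+1 * y ^+ (n - j).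
  rewrite tE big_ord_recl expr0 mulr1 [q 0%N + _]addrC addrK mulr_suml.
  apply: eq_bigr => j _; rewrite lift0 -mulrA; congr (_ * _).
  have jn : (j.+1 <= n.+1)%N by apply: leq_trans mn.
  rewrite -[in LHS](subnKC jn) exprD mulrA -exprMn mulrC [z * y]mulrC yz.
  by rewrite expr1n mulr1 subSS.
rewrite sE mulr_suml big_ord_recr /=; apply: adjoin_degD => //.
  apply: adjoin_deg_sum => // i _.
  rewrite mulrC mulrA; apply: adjoin_deg_mulX => //; first exact: PM.
  by rewrite -ltnS.
rewrite -mulrA [_ ^+ _ * _]mulrC tE' mulr_sumr.
apply: adjoin_deg_sum => // j _; rewrite mulrA.
apply: adjoin_deg_mulX; rewrite ?leq_subr //.
by apply: PM => //; apply: PO.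
Qed.

(** Descent on a relation in [y] and a relation in [z]: the one of larger degree is shortened by
    means of the other, until one of degree 0 puts an element of 1 + P into P. *)
Lemma adjoin_unit_proper y z : y * z = 1 -> ~ adjoin P y 1 \/ ~ adjoin P z 1.
Proof.
move=> yz; apply/not_andP => -[[n y1] [m z1]].
(* The constant 1 is relaxed to elements of 1 + P, since each reduction multiplies a relation by
   such an element. *)
have key N : forall y z s t n m, y * z = 1 -> (n + m <= N)%N ->
    P (1 - s) -> P (1 - t) -> adjoin_deg P y n s -> adjoin_deg P z m t -> False.
  move=> {y z yz n m y1 z1}; elim: N => [|N IH] y z s t n m yz.
    rewrite leqn0 addn_eq0 => /andP[/eqP-> _] Ps _ [p pP].
    by rewrite big_ord_recl big_ord0 expr0 mulr1 addr0 => sE; case: (unit_notin Ps); rewrite sE.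
  have zero x u : P (1 - u) -> ~ adjoin_deg P x 0 u.
    move=> Pu [p pP].
    by rewrite big_ord_recl big_ord0 expr0 mulr1 addr0 => uE; case: (unit_notin Pu); rewrite uE.
  case: n => [|n]; first by move=> _ Ps _ /zero.
  case: m => [|m]; first by move=> _ _ Pt _ /zero.
  move=> nmN Ps Pt ys zt.
  have [mn|nm] := leqP m n.
    have [s' Ps' ys'] := @adjoin_deg_reduce y z s t n m.+1 yz mn Ps Pt ys zt.
    by apply: (IH y z s' t n m.+1); rewrite //; lia.
  have zy : z * y = 1 by rewrite mulrC.
  have [t' Pt' zt'] := @adjoin_deg_reduce z y t s m n.+1 zy (ltnW nm) Pt Ps zt ys.
  by apply: (IH y z s t' n.+1 m); rewrite //; lia.
apply: (key (n + m)%N y z 1 1 n m) => //; rewrite subrr; exact: (si_zero OP).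
Qed.

(** Multiplying 1 = sum_j q_j z^j by y^m gives y^m in P, hence (y o)^m in P; but if y o is in 1 + P,
    so is its power. *)
Lemma adjoin_inv_proper y z : y * z = 1 -> O y ->
  ~ (exists2 o, O o & P (1 - y * o)) \/ ~ adjoin P z 1.
Proof.
move=> yz Oy; apply/not_andP => -[[o Oo Po] [m [q qP E]]].
have [O1 OD ON OM P0 PD PM PO] := OP.
have OX a k : O a -> O (a ^+ k).
  by move=> Oa; elim: k => [|k IH]; rewrite ?expr0 // exprS; apply: OM.
have Pym : P (y ^+ m).
  rewrite -[X in P X]mul1r E mulr_suml.
  elim/big_ind: _ => // j _; rewrite -mulrA mulrC; apply: PM => //.
  have jm : (j <= m)%N by rewrite -ltnS.
  have -> : y ^+ m = y ^+ j * y ^+ (m - j) by rewrite -exprD subnKC.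
  rewrite mulrA -exprMn [z * y]mulrC yz expr1n mul1r.
  exact: OX.
have : P (1 - (y * o) ^+ m).
  by elim: (m) => [|k IH]; rewrite ?expr0 ?subrr // exprS; apply: unit_mul.
move/unit_notin; apply.
by rewrite exprMn mulrC; apply: PM => //; apply: OX.
Qed.

End Chevalley.

(** * Enlarging a pair (O, P) until given units become comparable *)

Section Domination.
Context (B : comPzRingType).
Implicit Types (O P : B -> Prop) (y z : B).

(** For [y * z = 1] the cases model a value of [y] that is zero, positive or negative, with [P] as
    the elements of positive value. *)
Definition comparable_in O P y z := [\/ O y /\ O z, P y | P z].

Definition dominates O P O' P' :=
  [/\ subring_ideal O' P', ~ P' 1, (forall b, O b -> O' b) & forall b, P b -> P' b].

Lemma dominates_trans O P O1 P1 O2 P2 :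
  dominates O P O1 P1 -> dominates O1 P1 O2 P2 -> dominates O P O2 P2.
Proof. by move=> [_ _ h1 h2] [h3 h4 h5 h6]; split=> // b; auto. Qed.

Lemma dominates_adjoin O P y : subring_ideal O P -> ~ adjoin P y 1 ->
  dominates O P (adjoin O y) (adjoin P y).
Proof.
move=> H P1; split=> //; first exact: subring_ideal_adjoin.
  by move=> b; apply: adjoin_id; apply: (si_sub H); apply: (si_zero H).
by move=> b; apply: adjoin_id; apply: (si_zero H).
Qed.

Lemma comparable_sym O P y z : comparable_in O P y z -> comparable_in O P z y.
Proof. by case=> [[? ?]|?|?]; [apply: Or31|apply: Or33|apply: Or32]. Qed.

(** One first adjoins whichever of [y], [z] keeps the ideal proper. Once [y] is in the ring, either
    [P] and [y] generate a proper ideal, or [y] is invertible modulo [P] and [z] can be adjoined as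
    well. *)
Lemma dominates_comparable O P y z : subring_ideal O P -> ~ P 1 -> y * z = 1 ->
  exists O' P', dominates O P O' P' /\ comparable_in O' P' y z.
Proof.
have integral O0 P0 y0 z0 : subring_ideal O0 P0 -> ~ P0 1 -> y0 * z0 = 1 -> O0 y0 ->
    exists O' P', dominates O0 P0 O' P' /\ comparable_in O' P' y0 z0.
  move=> {O P y z}; move: O0 P0 y0 z0 => O P y z H P1 yz Oy.
  have [O1 OD ON OM P0 PD PM PO] := H.
  have [noto|adj] := adjoin_inv_proper H P1 yz Oy; last first.
    exists (adjoin O z), (adjoin P z); split; first exact: dominates_adjoin.
    constructor; split; last exact: adjoin_gen H.
    by apply: adjoin_id => //; apply: PO.
  (* The new ideal is P + yO, proper by [noto]. *)
  exists O, (fun b => exists2 o, O o & P (b - y * o)); split; last first.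
    by constructor 2; exists 1 => //; rewrite mulr1 subrr.
  split=> //; last first.
    by move=> b Pb; exists 0; [exact: PO|rewrite mulr0 subr0].
  split=> //.
  - by exists 0; [exact: PO|rewrite mulr0 subrr].
  - move=> a b [o Oo Pa] [o' Oo' Pb]; exists (o + o'); first exact: OD.
    by rewrite mulrDr opprD addrACA; apply: PD.
  - move=> a b Oa [o Oo Pb]; exists (a * o); first exact: OM.
    by rewrite mulrCA -mulrBr; apply: PM.
  - move=> a [o Oo Pa]; rewrite -(subrK (y * o) a); apply: OD; first exact: PO.
    exact: OM.
move=> H P1 yz.
have [adj|adj] := adjoin_unit_proper H P1 yz.
  have D := dominates_adjoin H adj; have [H' P'1 _ _] := D.
  have [O2 [P2 [D2 c2]]] := integral _ _ _ _ H' P'1 yz (adjoin_gen y H).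
  by exists O2, P2; split=> //; apply: dominates_trans D D2.
have D := dominates_adjoin H adj; have [H' P'1 _ _] := D.
have zy : z * y = 1 by rewrite mulrC.
have [O2 [P2 [D2 c2]]] := integral _ _ _ _ H' P'1 zy (adjoin_gen z H).
by exists O2, P2; split; [apply: dominates_trans D D2|apply: comparable_sym].
Qed.

(* Chevalley's extension theorem, restricted to finitely many units so that no
   maximal pair is needed. *)
Lemma dominates_comparable_fin O P (I : finType) (y z : I -> B) :
  subring_ideal O P -> ~ P 1 -> (forall i, y i * z i = 1) ->
  exists O' P', dominates O P O' P' /\ forall i, comparable_in O' P' (y i) (z i).
Proof.
move=> H P1 yz; suff [O' [P' [D c]]] : exists O' P', dominates O P O' P' /\
    forall i, i \in enum I -> comparable_in O' P' (y i) (z i).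
  by exists O', P'; split=> // i; apply: c; rewrite mem_enum.
elim: (enum I) O P H P1 => [|i s IH] O P H P1.
  by exists O, P; split=> //; split.
have [O1 [P1' [D1 c1]]] := dominates_comparable H P1 (yz i).
have [H1 P11 _ _] := D1; have [O2 [P2 [D2 c2]]] := IH O1 P1' H1 P11.
exists O2, P2; split; first exact: dominates_trans D1 D2.
move=> j; rewrite inE => /orP[/eqP->|/c2//]; have [_ _ OO PP] := D2.
by case: c1 => [[/OO ? /OO ?]|/PP ?|/PP ?]; [apply: Or31|apply: Or32|apply: Or33].
Qed.

End Domination.

(** * Evaluation of Laurent polynomials at torus points *)

Section Evaluation.
Context (K : fieldType) (T : finType).
Implicit Types (x : T -> K) (e : {ffun T -> int}) (f g : laurent K T).

Lemma monomial_evalD x e e' : torus K T x ->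
  monomial_eval x (e + e') = monomial_eval x e * monomial_eval x e'.
Proof.
by move=> xT; rewrite -big_split; apply: eq_bigr => t _; rewrite ffunE expfzDr.
Qed.

Lemma monomial_eval0 x : monomial_eval x 0 = 1.
Proof. by rewrite /monomial_eval big1 // => t _; rewrite ffunE expr0z. Qed.

Lemma monomial_eval_neq0 x e : torus K T x -> monomial_eval x e != 0.
Proof. by move=> xT; apply/prodf_neq0 => t _; rewrite expfz_neq0. Qed.

Lemma leval_widen x f (d : {fset {ffun T -> int}}) : (msupp f `<=` d)%fset ->
  leval x f = \sum_(e <- d) f@_e * monomial_eval x e.
Proof.
move=> fd; rewrite /leval (big_fset_incl _ fd) //= => e _ /mcoeff_outdom ->.
by rewrite mul0r.
Qed.

Lemma levalD x f g : leval x (f + g) = leval x f + leval x g.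
Proof.
rewrite (@leval_widen _ _ (msupp f `|` msupp g)%fset) ?msuppD_le //.
rewrite (@leval_widen _ f (msupp f `|` msupp g)%fset) ?fsubsetUl //.
rewrite (@leval_widen _ g (msupp f `|` msupp g)%fset) ?fsubsetUr //.
rewrite -big_split /=; apply: eq_bigr => e _.
by rewrite (mcoeffD e) mulrDl.
Qed.

Lemma leval0 x : leval x (0 : laurent K T) = 0.
Proof. by rewrite /leval msupp0 big_seq_fset0. Qed.

Lemma levalN x f : leval x (- f) = - leval x f.
Proof. by apply/eqP; rewrite -addr_eq0 -levalD addNr leval0. Qed.

Lemma leval_sum x (I : Type) (r : seq I) (p : pred I) (h : I -> laurent K T) :
  leval x (\sum_(i <- r | p i) h i) = \sum_(i <- r | p i) leval x (h i).
Proof. exact: (big_morph (leval x) (levalD x) (leval0 x)). Qed.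

Lemma leval_lterm x c e : leval x (lterm c e) = c * monomial_eval x e.
Proof.
rewrite (@leval_widen _ _ [fset e]%fset) ?msuppU_le //.
by rewrite big_seq_fset1 mcoeffUU.
Qed.

Lemma leval1 x : leval x (1 : laurent K T) = 1.
Proof. by rewrite (leval_lterm x 1 0) mul1r monomial_eval0. Qed.

Lemma levalM x f g : torus K T x -> leval x (f * g) = leval x f * leval x g.
Proof.
move=> xT; rewrite {1}/GRing.mul /= /lmul leval_sum mulr_suml.
apply: eq_bigr => e _; rewrite leval_sum mulr_sumr; apply: eq_bigr => e' _.
by rewrite leval_lterm monomial_evalD // mulrACA.
Qed.

(** If [g] vanishes on [X], its own zero locus is one of the closed sets intersected in the
    closure. *)
Lemma vanishing_ideal_closure (X : set (T -> K)) g : (X `<=` torus K T)%classic ->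
  vanishing_ideal (zariski_closure X) g <-> forall x, X x -> leval x g = 0.
Proof.
move=> XT; split=> [h x Xx|h x xX].
  by apply: h => G XG; apply: XG.
have [|_] := xX [set g]%classic; last exact.
by move=> y Xy; split; [exact: XT|move=> _ ->; apply: h].
Qed.

End Evaluation.

(** * Weights of exponents and initial forms *)

Section Weights.
Context (R : realType) (K : fieldType) (T : finType) (w : T -> R).
Implicit Types (e : {ffun T -> int}) (f g : laurent K T).

Lemma wdegB e e' : wdeg w (e - e') = wdeg w e - wdeg w e'.
Proof.
rewrite /wdeg -sumrB; apply: eq_bigr => t _.
by rewrite !ffunE rmorphB mulrBr.
Qed.

HB.instance Definition _ :=
  GRing.isZmodMorphism.Build {ffun T -> int} R (wdeg w) wdegB.

Definition wnneg g := forall e, e \in msupp g -> 0 <= wdeg w e.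
Definition wpos g := forall e, e \in msupp g -> 0 < wdeg w e.

Lemma supported_sum (S : {ffun T -> int} -> Prop) (I : eqType) (r : seq I)
    (h : I -> laurent K T) :
  (forall i, i \in r -> forall e, e \in msupp (h i) -> S e) ->
  forall e, e \in msupp (\sum_(i <- r) h i) -> S e.
Proof.
move=> hS; rewrite big_seq; elim/big_ind: _ => //.
  by move=> e; rewrite msupp0.
move=> f g Sf Sg e /(fsubsetP (msuppD_le f g)).
by rewrite in_fsetU => /orP[/Sf|/Sg].
Qed.

Lemma supported_lterm (S : {ffun T -> int} -> Prop) (c : K) e :
  S e -> forall e', e' \in msupp (lterm c e) -> S e'.
Proof.
by move=> Se e' /(fsubsetP msuppU_le); rewrite in_fset1 => /eqP->.
Qed.

Lemma supportedM (S S' S'' : {ffun T -> int} -> Prop) f g :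
  (forall e e', S e -> S' e' -> S'' (e + e')) ->
  (forall e, e \in msupp f -> S e) -> (forall e, e \in msupp g -> S' e) ->
  forall e, e \in msupp (f * g : laurent K T) -> S'' e.
Proof.
move=> SS Sf Sg; rewrite {1}/GRing.mul /= /lmul.
apply: supported_sum => e1 /Sf S1; apply: supported_sum => e2 /Sg S2.
by apply: supported_lterm; apply: SS.
Qed.

(** The exponent 0 has weight 0, so it does not occur in [g]; all other exponents of [1 - g] have
    positive weight, which leaves the constant term 1 alone at the minimum. *)
Lemma initial_form_1sub g : wpos g -> initial_form w (1 - g) = lterm 1 0.
Proof.
move=> gpos.
have coef e : (1 - g : laurent K T)@_e = (0 == e)%:R - g@_e.
  by rewrite (mcoeffB e) /= (mcoeffU 0 1).
have g0 : g@_0 = 0.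
  by apply: mcoeff_outdom; apply/negP => /gpos; rewrite raddf0 ltxx.
have supp0 : 0 \in msupp (1 - g) by rewrite -mcoeff_neq0 coef eqxx g0 subr0 oner_eq0.
have supp_pos e : e \in msupp (1 - g) -> e != 0 -> 0 < wdeg w e.
  rewrite -mcoeff_neq0 coef [0 == e]eq_sym => h /negPf e0; apply: gpos.
  by move: h; rewrite e0 sub0r oppr_eq0 mcoeff_neq0.
rewrite /initial_form big_mkcond (bigD1_seq (0 : {ffun T -> int})) ?fset_uniq //=.
rewrite ifT ?big1 ?addr0; last first.
- by apply/allP => e eS; have [->//|/(supp_pos _ eS)/ltW] := eqVneq e 0; rewrite raddf0.
- move=> e e0; case: ifP => // /allP/(_ _ supp0); rewrite raddf0 leNgt => /negP h.
  by rewrite mcoeff_outdom ?lterm0 //; apply/negP => /supp_pos/(_ e0).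
by rewrite coef eqxx g0 subr0.
Qed.

End Weights.

Lemma total_min (I : finType) (i0 : I) (le : I -> I -> Prop) :
  (forall i j, le i j \/ le j i) ->
  (forall i j l, le i j -> le j l -> le i l) ->
  exists i, forall j, le i j.
Proof.
move=> le_total le_trans.
suff H (s : seq I) : exists i, forall j, j \in s -> le i j.
  by have [i hi] := H (enum I); exists i => j; apply: hi; rewrite mem_enum.
elim: s => [|j s [i hi]]; first by exists i0.
have [ij|ji] := le_total i j; first by exists i => l; rewrite inE => /orP[/eqP->|/hi].
exists j => l; rewrite inE => /orP[/eqP->|/hi]; last exact: le_trans.
by have [] := le_total j j.
Qed.

(** * From initial ideals without monomials to tropical solutions *)

Section Incidence.
Context (R : realType) (k n : nat) (m : 'I_k -> nat).
Context (a : forall i : 'I_k, 'I_(m i) -> {ffun 'I_n -> int}).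
Local Notation T := (coef_index m).
Local Notation C := R[i].

Definition incidence (c : T -> C) (x : 'I_n -> C) : Prop :=
  [/\ torus C T c, torus C 'I_n x &
    forall i : 'I_k, \sum_(j < m i) c (existT _ i j) * monomial_eval x (a j) = 0].

Lemma vanishing_resultant (g : laurent C T) :
  vanishing_ideal (resultant_variety R a) g <->
  forall c x, incidence c x -> leval c g = 0.
Proof.
apply: (iff_trans (vanishing_ideal_closure _ _)); first by move=> c [].
split=> [h c x [cT xT cx]|h c [cT [x xT cx]]]; last exact: (h c x).
by apply: h; split=> //; exists x.
Qed.

(** All complex functions on this type form the ambient ring of the extension argument: polynomials
    congruent modulo the ideal of the incidence variety become equal there. That ring may be zero,
    so no point has to be exhibited. *)
Definition incidence_point := {p : (T -> C) * ('I_n -> C) | incidence p.1 p.2}.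
Local Notation B := (incidence_point -> C).
Local Notation V := ({ffun T -> int} * {ffun 'I_n -> int})%type.

Definition mono (v : V) : B := fun y =>
  monomial_eval (sval y).1 v.1 * monomial_eval (sval y).2 v.2.

Lemma monoD u v : mono (u + v) = mono u * mono v.
Proof.
apply/funext => y; have [cT xT _] := svalP y.
by rewrite /mono /= !monomial_evalD // mulrACA.
Qed.

Lemma mono0 : mono 0 = 1.
Proof. by apply/funext => y; rewrite /mono !monomial_eval0 mulr1. Qed.

Definition delta (t : T) : {ffun T -> int} := [ffun t' => (t' == t)%:R].

(** The exponent vector of u_ij = c_ij x^(a_ij). *)
Definition coef_term (t : T) : V := (delta t, a (tagged t)).

Lemma mono_coef_term t y :
  mono (coef_term t) y = (sval y).1 t * monomial_eval (sval y).2 (a (tagged t)).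
Proof.
rewrite /mono /=; congr (_ * _); rewrite /monomial_eval (bigD1 t) //= big1.
  by rewrite ffunE eqxx mulr1 expr1z.
by move=> t' /negPf t't; rewrite ffunE t't expr0z.
Qed.

Lemma sum_coef_term i : \sum_(j < m i) mono (coef_term (existT _ i j)) = 0.
Proof.
apply/funext => y; have [_ _ cx] := svalP y.
rewrite fct_sumE -[RHS](cx i); apply: eq_bigr => j _; exact: mono_coef_term.
Qed.

Context (w : T -> R).

Definition weight_ring (b : B) : Prop :=
  exists2 g : laurent C T, wnneg w g & forall y, b y = leval (sval y).1 g.
Definition weight_ideal (b : B) : Prop :=
  exists2 g : laurent C T, wpos w g & forall y, b y = leval (sval y).1 g.

Lemma weight_subring_ideal : subring_ideal weight_ring weight_ideal.
Proof.
have levalMy (y : incidence_point) f g :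
    leval (sval y).1 (f * g) = leval (sval y).1 f * leval (sval y).1 g.
  by rewrite levalM //; have [] := svalP y.
have wD (S : R -> bool) (f g : laurent C T) :
    (forall e, e \in msupp f -> S (wdeg w e)) ->
    (forall e, e \in msupp g -> S (wdeg w e)) ->
    forall e, e \in msupp (f + g) -> S (wdeg w e).
  move=> Sf Sg e /(fsubsetP (msuppD_le f g)).
  by rewrite in_fsetU => /orP[/Sf|/Sg].
split.
- exists 1; last by move=> y; rewrite leval1.
  by apply: (supported_lterm (S := fun e => 0 <= wdeg w e)); rewrite raddf0.
- move=> b c [f fw bf] [g gw cg]; exists (f + g); first exact: (wD (fun r => 0 <= r)).
  by move=> y; rewrite levalD -bf -cg.
- move=> b [f fw bf]; exists (- f); last by move=> y; rewrite levalN -bf.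
  by move=> e; rewrite msuppN; apply: fw.
- move=> b c [f fw bf] [g gw cg]; exists (f * g); last by move=> y; rewrite levalMy -bf -cg.
  apply: (supportedM (S := fun e => 0 <= wdeg w e) (S' := fun e => 0 <= wdeg w e)) => //.
  by move=> e e' h h'; rewrite raddfD addr_ge0.
- exists 0; last by move=> y; rewrite leval0.
  by move=> e; rewrite msupp0.
- move=> b c [f fw bf] [g gw cg]; exists (f + g); first exact: (wD (fun r => 0 < r)).
  by move=> y; rewrite levalD -bf -cg.
- move=> b c [f fw bf] [g gw cg]; exists (f * g); last by move=> y; rewrite levalMy -bf -cg.
  apply: (supportedM (S := fun e => 0 <= wdeg w e) (S' := fun e => 0 < wdeg w e)) => //.
  by move=> e e' h h'; rewrite raddfD ltr_wpDl.
- by move=> b [f fw bf]; exists f => // e /fw /ltW.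
Qed.

Lemma weight_ideal_proper :
  trop_support (vanishing_ideal (resultant_variety R a)) w -> ~ weight_ideal 1.
Proof.
move=> trop_w [g gw g1]; apply: trop_w; exists 0 => I [_ sub]; apply: sub.
exists (1 - g); last exact: initial_form_1sub.
apply/vanishing_resultant => c x cx.
rewrite levalD levalN leval1.
by rewrite -(g1 (exist _ (c, x) cx)) subrr.
Qed.

Lemma coef_term_wdeg t t' : wdeg w (delta t - delta t') = w t - w t'.
Proof.
have deg s : wdeg w (delta s) = w s.
  rewrite /wdeg (bigD1 s) //= big1 ?addr0 => [|s' /negPf ss'].
    by rewrite ffunE eqxx mulr1.
  by rewrite ffunE ss' mulr0.
by rewrite wdegB !deg.
Qed.

Definition mono_weight (v : V) : R := wdeg w v.1.
Definition mono_coord (l : 'I_n) (v : V) : int := v.2 l.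

Lemma mono_weight_is_zmod : zmod_morphism mono_weight.
Proof. by move=> u v; rewrite /mono_weight /= wdegB. Qed.

Lemma mono_coord_is_zmod l : zmod_morphism (mono_coord l).
Proof. by move=> u v; rewrite /mono_coord /= !ffunE. Qed.

HB.instance Definition _ :=
  GRing.isZmodMorphism.Build V R mono_weight mono_weight_is_zmod.
HB.instance Definition _ l :=
  GRing.isZmodMorphism.Build V int (mono_coord l) (mono_coord_is_zmod l).

(** Translates the linear form attached to the ratio u_ij / u_ij' into a comparison of two tropical
    terms. *)
Lemma trop_term_sub (i : 'I_k) (j j' : 'I_(m i)) (x : 'I_n -> R) :
  let v := coef_term (existT _ i j) - coef_term (existT _ i j') in
  mono_weight v + \sum_(l < n) (mono_coord l v)%:~R * x l =
  trop_term (@a i) (fun j => w (existT _ i j)) x j -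
  trop_term (@a i) (fun j => w (existT _ i j)) x j'.
Proof.
rewrite /mono_weight /mono_coord /= coef_term_wdeg /trop_term opprD addrACA; congr (_ + _).
rewrite -sumrB; apply: eq_bigr => l _.
by rewrite !ffunE rmorphB mulrBl.
Qed.

Lemma trop_support_sub_resultant : (forall i, (2 <= m i)%N) ->
  trop_support (vanishing_ideal (resultant_variety R a)) w ->
  tropical_resultant R a w.
Proof.
move=> m_ge2 /weight_ideal_proper Pw.
(* The ratios are Laurent monomials, hence units, and swapping the indices inverts them; the
   extension is made for all pairs at once. *)
pose ratio t t' := mono (coef_term t - coef_term t').
have ratioM t1 t2 t3 : ratio t1 t2 * ratio t2 t3 = ratio t1 t3.
  by rewrite -monoD addrA subrK.
have ratio1 t : ratio t t = 1 by rewrite /ratio subrr mono0.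
have [|O [P [[OP P1 wO wP] cmp_all]]] :=
    dominates_comparable_fin (y := fun tt : T * T => ratio tt.1 tt.2)
      (z := fun tt => ratio tt.2 tt.1) weight_subring_ideal Pw.
  by move=> tt; rewrite ratioM ratio1.
have cmp t t' : comparable_in O P (ratio t t') (ratio t' t) := cmp_all (t, t').
have [O1 OD ON OM P0 PD PM PO] := OP.
(* Divisibility in [O] is a total preorder on the u_ij, and [j] is least for it. *)
have min1 i : exists j, forall j' : 'I_(m i), O (ratio (existT _ i j') (existT _ i j)).
  have j0 : 'I_(m i) by exists 0%N; apply: leq_trans (m_ge2 i).
  apply: (total_min j0 (le := fun j j' => O (ratio (existT _ i j') (existT _ i j)))).
    by move=> j j'; case: (cmp (existT _ i j) (existT _ i j')) => [[]|/PO|/PO]; auto.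
  by move=> j1 j2 j3 h h'; rewrite -(ratioM _ (existT _ i j2)); apply: OM.
(* A second index [j'] with u_ij' / u_ij outside [P] is wanted: comparability then makes the two
   monomials divide each other. *)
have min2 i : exists jj : 'I_(m i) * 'I_(m i), [/\ jj.1 != jj.2,
    forall j', O (ratio (existT _ i j') (existT _ i jj.1)) &
    O (ratio (existT _ i jj.1) (existT _ i jj.2))].
  have [j hj] := min1 i.
  have [[j' j'j nP]|allP] :=
      pselect (exists2 j', j' != j & ~ P (ratio (existT _ i j') (existT _ i j))).
    exists (j, j'); split=> //=; first by rewrite eq_sym.
    have [[_ //]|//|Pj] := cmp (existT _ i j') (existT _ i j).
    case: P1; rewrite -(ratio1 (existT _ i j)) -(ratioM _ (existT _ i j')) mulrC.
    exact: PM.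
  (* If all other ratios lay in [P], dividing sum_j u_ij = 0 by the least u_ij would put 1 in
     [P]. *)
  case: P1; have -> : 1 = - \sum_(j' < m i | j' != j) ratio (existT _ i j') (existT _ i j).
    apply/eqP; rewrite -addr_eq0 -(ratio1 (existT _ i j)).
    rewrite -(bigD1 (P := predT) j) //=.
    under eq_bigr => j' _ do rewrite /ratio monoD.
    by rewrite -mulr_suml sum_coef_term mul0r.
  rewrite -mulN1r; apply: PM; first exact: ON.
  elim/big_ind: _ => // j' j'j; apply: contrapT => nP; apply: allP; by exists j'.
pose jj i := sval (cid (min2 i)); have jjP i := svalP (cid (min2 i)).
(* The first family makes the term [(jj i).1] minimal, the second makes [(jj i).2] no larger than
   it. *)
pose vs := [seq coef_term t - coef_term (existT _ (tag t) (jj (tag t)).1) | t <- enum (predT : pred T)] ++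
  [seq coef_term (existT _ i (jj i).1) - coef_term (existT _ i (jj i).2) | i <- enum 'I_k].
have [|||x xP] := @fourier_motzkin _ V n (fun l => mono_coord l) mono_weight
    (fun v => O (mono v)) vs.
- by move=> u v; rewrite monoD; apply: OM.
- move=> v; rewrite mem_cat => /orP[] /mapP[].
    by move=> [i j] _ -> /=; have [_ + _] := jjP i; apply.
  by move=> i _ ->; have [] := jjP i.
- move=> v Ov v2; rewrite leNgt; apply/negP => vneg.
  case: P1; rewrite -mono0 -(subrr v) monoD; apply: PM => //.
  apply: wP; exists (lterm 1 (- v.1)).
    by apply: (supported_lterm (S := fun e => 0 < wdeg w e)); rewrite raddfN oppr_gt0.
  move=> y; rewrite leval_lterm mul1r /mono /=.
  have -> : - v.2 = 0 by apply/ffunP => l; rewrite !ffunE [v.2 l]v2 oppr0.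
  by rewrite monomial_eval0 mulr1.
exists x => i; have [jj_neq _ _] := jjP i.
have min_i j' : trop_term (@a i) (fun j => w (existT _ i j)) x (jj i).1 <=
    trop_term (@a i) (fun j => w (existT _ i j)) x j'.
  rewrite -subr_ge0 -trop_term_sub; apply: xP.
  rewrite mem_cat; apply/orP; left.
  by apply/mapP; exists (existT _ i j'); rewrite ?mem_enum.
have le_i : trop_term (@a i) (fun j => w (existT _ i j)) x (jj i).2 <=
    trop_term (@a i) (fun j => w (existT _ i j)) x (jj i).1.
  rewrite -subr_ge0 -trop_term_sub; apply: xP.
  by rewrite mem_cat; apply/orP; right; apply/mapP; exists i; rewrite ?mem_enum.
apply/card_gt1P; exists (jj i).1, (jj i).2; split=> //.
  by apply/forallP.
by apply/forallP => j'; apply: le_trans le_i (min_i j').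
Qed.

End Incidence.

(** * Limits along exponential curves *)

Section ExponentialCurves.
Context (R : realType).
Local Open Scope classical_set_scope.

Lemma cvg_expR_decay (d : R) : 0 < d -> expR (- (s * d)) @[s --> +oo] --> 0.
Proof.
move=> d0; apply: (cvg_comp (fun s => s * d) (fun s => expR (- s))); last exact: cvgr_expR.
by apply: gt0_cvgMly => //; apply: cvg_id.
Qed.

Lemma cvg_exprz (f : R -> R) (l : R) (z : int) : l != 0 ->
  f s @[s --> +oo] --> l -> f s ^ z @[s --> +oo] --> l ^ z.
Proof.
move=> l0 fl.
have fX k : f s ^+ k @[s --> +oo] --> l ^+ k.
  elim: k => [|k IH]; first exact: cvg_cst.
  rewrite exprS; under eq_fun do rewrite exprS.
  exact: cvgM.
case: z => k; first exact: fX.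
by rewrite NegzE -exprnN; apply: cvgV (fX k.+1); rewrite expf_neq0.
Qed.

Lemma cvg_monomial_eval (T : finType) (h : R -> T -> R) (p : T -> R) e :
  (forall t, p t != 0) -> (forall t, h s t @[s --> +oo] --> p t) ->
  monomial_eval (h s) e @[s --> +oo] --> monomial_eval p e.
Proof.
move=> p0 hp; apply: cvg_big; first exact: mul_continuous.
by move=> t _; apply: cvg_exprz.
Qed.

Lemma Re_sum (I : eqType) (r : seq I) (b : I -> R[i]) (f : I -> R) :
  complex.Re (\sum_(e <- r) b e * (f e)%:C%C) = \sum_(e <- r) complex.Re (b e) * f e.
Proof.
elim: r => [|e r IH]; rewrite ?big_nil // !big_cons -IH.
by case: (b e) (\sum_(_ <- _) _) => [u v] [u' v'] /=; rewrite mulr0 subr0.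
Qed.

Lemma Im_sum (I : eqType) (r : seq I) (b : I -> R[i]) (f : I -> R) :
  complex.Im (\sum_(e <- r) b e * (f e)%:C%C) = \sum_(e <- r) complex.Im (b e) * f e.
Proof.
elim: r => [|e r IH]; rewrite ?big_nil // !big_cons -IH.
by case: (b e) (\sum_(_ <- _) _) => [u v] [u' v'] /=; rewrite mulr0 add0r.
Qed.

(** Real and imaginary parts are treated separately, so that only limits of real functions occur. *)
Lemma relation_limit (I : eqType) (r : seq I) (b : I -> R[i]) (f : I -> R -> R) (l : I -> R) :
  (forall e, e \in r -> f e s @[s --> +oo] --> l e) ->
  (forall s, \sum_(e <- r) b e * (f e s)%:C%C = 0) ->
  \sum_(e <- r) b e * (l e)%:C%C = 0.
Proof.
move=> fl f0.
have lim0 (c : I -> R) : (forall s, \sum_(e <- r) c e * f e s = 0) ->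
    \sum_(e <- r) c e * l e = 0.
  move=> cf0; rewrite big_seq.
  have : \sum_(e <- r | e \in r) c e * f e s @[s --> +oo] -->
      \sum_(e <- r | e \in r) c e * l e.
    apply: cvg_big; first exact: add_continuous.
    by move=> e /fl; apply: cvgMr.
  under eq_fun do rewrite -big_seq cf0.
  by move=> cl; apply: (cvg_unique (@Rhausdorff R) cl); exact: cvg_cst.
apply/eqP; rewrite eq_complex Re_sum Im_sum !lim0 ?eqxx //= => s.
  by rewrite -Im_sum f0.
by rewrite -Re_sum f0.
Qed.

Lemma monomial_eval_expR (T : finType) (w : T -> R) s e :
  monomial_eval (fun t => expR (- (s * w t))) e = expR (- (s * wdeg w e)).
Proof.
have expRz y (z : int) : expR y ^ z = expR (y * z%:~R).
  case: z => q; first by rewrite expRM_natr.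
  by rewrite NegzE -exprnN mulrNz mulrN expRN expRM_natr.
rewrite /wdeg mulr_sumr -sumrN expR_sum; apply: eq_bigr => t _.
by rewrite expRz mulNr mulrA.
Qed.

Lemma monomial_eval_mul (T : finType) (x y : T -> R) e :
  monomial_eval (fun t => x t * y t) e = monomial_eval x e * monomial_eval y e.
Proof. by rewrite -big_split; apply: eq_bigr => t _; rewrite expfzMl. Qed.

Lemma monomial_eval_real_complex (T : finType) (x : T -> R) e :
  monomial_eval (fun t => (x t)%:C%C) e = (monomial_eval x e)%:C%C.
Proof. by rewrite rmorph_prod; apply: eq_bigr => t _; rewrite fmorphXz. Qed.

(** Multiplication by exp(s d), where d is the least weight in [g], makes the terms of larger weight
    decay, while those of weight d tend to their values at [p]. *)
Lemma leval_initial_form_limit (T : finType) (g : laurent R[i] T) (w : T -> R)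
    (h : R -> T -> R) (p : T -> R) :
  (forall t, p t != 0) -> (forall t, h s t @[s --> +oo] --> p t) ->
  (forall s, leval (fun t => (expR (- (s * w t)) * h s t)%:C%C) g = 0) ->
  leval (fun t => (p t)%:C%C) (initial_form w g) = 0.
Proof.
move=> p0 hp g0; rewrite /initial_form leval_sum.
(* Without a minimal exponent, as for g = 0, the initial form is an empty sum. *)
have [/hasP[e0 e0S /allP e0min]|/hasPn nomin] := boolP (has
    (fun e => all (fun e' => wdeg w e <= wdeg w e') (msupp g)) (msupp g)); last first.
  by rewrite big_seq_cond big1 // => e /andP[/nomin/negPf->].
rewrite big_mkcond /=.
pose l e := if wdeg w e == wdeg w e0 then monomial_eval p e else 0.
rewrite -[RHS](@relation_limit _ (msupp g) (fun e => g@_e)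
   (fun e s => expR (- (s * (wdeg w e - wdeg w e0))) * monomial_eval (h s) e) l).
- rewrite big_seq [RHS]big_seq; apply: eq_bigr => e eS.
  rewrite leval_lterm monomial_eval_real_complex /l.
  have -> : all (fun e' => wdeg w e <= wdeg w e') (msupp g) = (wdeg w e == wdeg w e0).
    apply/allP/eqP => [emin|-> //]; apply/eqP; rewrite eq_le.
    by rewrite emin // e0min.
  by case: ifP => // _; rewrite rmorph0 mulr0.
- move=> e eS; rewrite /l; case: eqVneq => [->|ne].
    under eq_fun do rewrite subrr mulr0 oppr0 expR0 mul1r.
    exact: cvg_monomial_eval.
  rewrite -(mul0r (monomial_eval p e)); apply: cvgM; last exact: cvg_monomial_eval.
  by apply: cvg_expR_decay; rewrite subr_gt0 lt_neqAle eq_sym ne e0min.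
move=> s; rewrite -[RHS](mulr0 (expR (s * wdeg w e0))%:C%C) -[X in _ = _ * X](g0 s) /leval mulr_sumr.
apply: eq_bigr => e _; rewrite monomial_eval_real_complex monomial_eval_mul.
rewrite monomial_eval_expR mulrCA -rmorphM mulrA -expRD.
by congr (_ * (expR _ * _)%:C%C); ring.
Qed.

End ExponentialCurves.

(** * From tropical solutions to initial ideals without monomials *)

Section Converse.
Context (R : realType) (k n : nat) (m : 'I_k -> nat).
Context (a : forall i : 'I_k, 'I_(m i) -> {ffun 'I_n -> int}).
Local Notation T := (coef_index m).

Lemma trop_termE i (c : 'I_(m i) -> R) x j :
  trop_term (@a i) c x j = c j + wdeg x (a j).
Proof. by congr (_ + _); apply: eq_bigr => l _; rewrite mulrC. Qed.

(** The polynomials vanishing at [p] form an ideal containing all the initial forms, hence the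
    initial ideal; a monomial has no zero in the torus. *)
Lemma initial_ideal_vanish (K : fieldType) (S : finType) (w : S -> R)
    (I : set (laurent K S)) (p : S -> K) :
  torus K S p -> (forall g, I g -> leval p (initial_form w g) = 0) ->
  trop_support I w.
Proof.
move=> pT pI [e eI]; suff : leval p (lterm 1 e) = 0.
  by apply/eqP; rewrite leval_lterm mul1r monomial_eval_neq0.
apply: (eI [set g | leval p g = 0]%classic); split; last by move=> _ [g Ig <-]; apply: pI.
split=> /= [|f g f0 g0|f g g0]; first exact: leval0.
  by rewrite levalD f0 g0 addr0.
by rewrite levalM // g0 mulr0.
Qed.

Lemma resultant_sub_trop_support (w : T -> R) : tropical_resultant R a w ->
  trop_support (vanishing_ideal (resultant_variety R a)) w.
Proof.
move=> [x trop_x].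
pose v i j : R := trop_term (@a i) (fun j => w (existT _ i j)) x j.
have min2 i : exists jj : 'I_(m i) * 'I_(m i), [/\ jj.2 != jj.1,
    v i jj.2 = v i jj.1 & forall j, v i jj.1 <= v i j].
  have /card_gt1P[j [j' [/forallP jmin /forallP j'min jj']]] := trop_x i.
  exists (j', j); split=> //=.
  by apply/eqP; rewrite eq_le; apply/andP; split; [apply: jmin|apply: j'min].
pose j0 i := (sval (cid (min2 i))).1; pose j1 i := (sval (cid (min2 i))).2.
have jP i : [/\ j1 i != j0 i, v i (j1 i) = v i (j0 i) & forall j, v i (j0 i) <= v i j].
  exact: svalP (cid (min2 i)).
pose gap i j : R := v i j - v i (j0 i).
(* On the curve x_l(s) = exp(-s x_l), c_ij(s) = exp(-s w_ij) h_ij(s), the monomial u_ij equals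
   exp(-s v_ij) h_ij(s). All h_ij are 1 except at [j0 i], where the i-th equation is solved. *)
pose h s (t : T) : R := if tagged t == j0 (tag t)
  then - \sum_(j < m (tag t) | j != j0 (tag t)) expR (- (s * gap (tag t) j)) else 1.
(* The limit of [h]: exp(-s gap) tends to 1 or to 0 according to whether the gap vanishes. *)
pose p (t : T) : R := if tagged t == j0 (tag t)
  then - \sum_(j < m (tag t) | j != j0 (tag t)) (gap (tag t) j == 0)%:R else 1.
(* The second minimal index [j1 i] contributes 1 to a sum of non-negative terms; with a unique
   minimum the limit would leave the torus. *)
have p_neq0 t : p t != 0.
  case: t => i j; rewrite /p /=; case: ifP => _; last exact: oner_neq0.
  have [j1j0 vj _] := jP i; rewrite oppr_eq0 (bigD1 (j1 i)) //= /gap vj subrr eqxx.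
  by rewrite gt_eqF // ltr_pwDl // sumr_ge0.
have h_neq0 s t : h s t != 0.
  case: t => i j; rewrite /h /=; case: ifP => _; last exact: oner_neq0.
  have [j1j0 vj _] := jP i; rewrite oppr_eq0 (bigD1 (j1 i)) //=.
  by rewrite gt_eqF // ltr_pwDl ?expR_gt0 // sumr_ge0 // => *; apply: expR_ge0.
have hp t : (h s t @[s --> +oo] --> p t)%classic.
  case: t => i j; rewrite /h /p /=; case: ifP => _; last exact: cvg_cst.
  apply: cvgN; apply: cvg_big; first exact: add_continuous.
  move=> j' _; have [_ _ /(_ j') jmin] := jP i; case: eqVneq => [->|gap0].
    under eq_fun do rewrite mulr0 oppr0 expR0.
    exact: cvg_cst.
  by apply: cvg_expR_decay; rewrite lt_neqAle eq_sym gap0 subr_ge0.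
apply: (@initial_ideal_vanish _ _ _ _ (fun t => (p t)%:C%C)).
  by move=> t; rewrite fmorph_eq0.
move=> g /vanishing_resultant g0; apply: (@leval_initial_form_limit _ _ _ _ h) => // s.
apply: (g0 _ (fun l => (expR (- (s * x l)))%:C%C)); split.
- by move=> t; rewrite fmorph_eq0 mulf_neq0 // gt_eqF ?expR_gt0.
- by move=> l; rewrite fmorph_eq0 gt_eqF ?expR_gt0.
move=> i; transitivity ((\sum_(j < m i) expR (- (s * v i j)) * h s (existT _ i j))%:C%C).
  rewrite rmorph_sum; apply: eq_bigr => j _.
  rewrite /v trop_termE monomial_eval_real_complex -rmorphM monomial_eval_expR.
  by rewrite mulrAC -expRD -opprD -mulrDr.
(* The summands of [h] at [j0 i], multiplied by exp(-s v_i,j0), cancel the other terms one by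
   one. *)
rewrite (bigD1 (j0 i)) //= {1}/h /= eqxx mulrN mulr_sumr addrC.
rewrite (_ : _ - _ = 0) ?rmorph0 //; apply/eqP; rewrite subr_eq0; apply/eqP.
apply: eq_bigr => j /negPf jj0; rewrite /h /= jj0 mulr1 -expRD; congr expR.
by rewrite /gap; ring.
Qed.

End Converse.

Theorem theorem2p4 (R : realType) (k n : nat) (m : 'I_k -> nat)
  (m_ge2 : forall i : 'I_k, (2 <= m i)%N)
  (a : forall i : 'I_k, 'I_(m i) -> {ffun 'I_n -> int}) :
  trop_support (vanishing_ideal (resultant_variety R a))
  = tropical_resultant R a.
Proof.
apply/seteqP; split=> w; first exact: trop_support_sub_resultant.
exact: resultant_sub_trop_support.
Qed.
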